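(* Let $n\ge 1$ be an integer and let $x,y$ be complex numbers such that no denominator below vanishes, i.e. $x\notin\{-1,\dots,-n\}$, $x-y\notin\{-1,\dots,-n\}$ and $y\notin\{-n,-n+1,\dots,n-1\}$. Then $$\sum_{k=0}^n(-1)^k\binom{n}{k}\frac{\binom{y+k}{k}}{\binom{y-n+k}{k}}\frac{y}{y+k}H_{k}^{\langle2\rangle}(x)=\frac{(-1)^n}{n}\,\frac{\binom{x-y+n}{n}}{\binom{x+n}{n}\binom{y}{n}}\Big\{H_{n}(x-y)-H_{n}(x)\Big\}.$$
   Context: For a complex number $u$ and an integer $k\ge 0$, $\binom{u}{k}=\frac{u(u-1)\cdots(u-k+1)}{k!}$ (equal to $1$ for $k=0$). For a complex number $u$ and a positive integer $\ell$, the generalized harmonic numbers of $\ell$-order are $H_0^{\langle\ell\rangle}(u)=0$ and $H_n^{\langle\ell\rangle}(u)=\sum_{k=1}^n\frac{1}{(u+k)^\ell}$ for $n\ge1$; $H_n(u)=H_n^{\langle1\rangle}(u)$. *)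

(* Defs.v *)
From mathcomp Require Import all_boot all_order all_algebra.

Set Implicit Arguments.
Unset Strict Implicit.
Unset Printing Implicit Defensive.

Import GRing.Theory.
Local Open Scope ring_scope.

(* Meaningful when k! is invertible in K, e.g. in characteristic 0. *)
Definition gbinom (K : fieldType) (u : K) (k : nat) : K :=
  (\prod_(0 <= i < k) (u - i%:R)) / k`!%:R.

(* The order l comes first: [gharmonic l n u] is $H_n^{\langle l\rangle}(u)$. *)
Definition gharmonic (K : fieldType) (l n : nat) (u : K) : K :=
  \sum_(1 <= k < n.+1) 1 / (u + k%:R) ^+ l.

(* Main.v *)
(** Write (u)_k for the rising factorial. The coefficient of H_k^{<2>}(x) is
    (-n)_k (y)_k / (k! (y-n+1)_k), whose partial sums have the closed form
    (1-n)_m (y+1)_m / (m! (y-n+1)_m), which vanishes at m = n. Summation by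
    parts therefore turns the left-hand side into a combination of the
    1 / (x+m+1)^2 for m < n. Up to a constant factor the right-hand side is the
    derivative at x of the rational function (x-y+1)_n / (x+1)_n, and its
    partial fraction expansion has exactly the same coefficients. *)

Require Import Defs.
From mathcomp Require Import all_boot all_order all_algebra.
From mathcomp Require Import reals complex ring zify.

Set Implicit Arguments.
Unset Strict Implicit.
Unset Printing Implicit Defensive.

Import Order.TTheory GRing.Theory Num.Theory.

Local Open Scope ring_scope.
Local Open Scope complex_scope.

(** * Rising factorials *)

Definition rising (K : fieldType) (u : K) (k : nat) : K :=
  \prod_(0 <= i < k) (u + i%:R).

Lemma rising0 (K : fieldType) (u : K) : rising u 0 = 1.
Proof. by rewrite /rising big_nil. Qed.

Lemma risingS (K : fieldType) (u : K) k :
  rising u k.+1 = rising u k * (u + k%:R).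
Proof. by rewrite /rising big_nat_recr. Qed.

Lemma risingSl (K : fieldType) (u : K) k :
  rising u k.+1 = u * rising (u + 1) k.
Proof.
rewrite /rising big_nat_recl // addr0; congr (_ * _).
by apply: eq_bigr => i _; rewrite -addrA -natr1 [1 + _]addrC.
Qed.

Lemma risingD (K : fieldType) (u : K) m n :
  rising u (m + n) = rising u m * rising (u + m%:R) n.
Proof.
elim: n => [|n IHn]; first by rewrite addn0 rising0 mulr1.
by rewrite addnS !risingS IHn natrD addrA mulrA.
Qed.

Lemma rising_neq0 (K : fieldType) (u : K) k :
  (forall i, (i < k)%N -> u + i%:R != 0) -> rising u k != 0.
Proof.
move=> u_neq0; rewrite /rising prodf_seq_neq0; apply/allP => i.
by rewrite mem_index_iota => /= /u_neq0.
Qed.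

Lemma rising_rev (K : fieldType) (u : K) k :
  \prod_(i < k) (u - i%:R) = rising (u - k%:R + 1) k.
Proof.
rewrite (reindex_inj rev_ord_inj) /rising big_mkord.
apply: eq_bigr => i _ /=; rewrite natrB ?ltn_ord // -[i.+1]addn1 natrD; ring.
Qed.

Lemma gbinom_rising (K : fieldType) (u : K) k :
  gbinom (u + k%:R) k = rising (u + 1) k / k`!%:R.
Proof. by rewrite /gbinom big_mkord rising_rev addrK. Qed.

(** * Partial fractions and logarithmic derivatives of split polynomials *)

Lemma horner_prod_XsubC (K : fieldType) (I : finType) (P : pred I)
    (c : I -> K) (x : K) :
  (\prod_(i | P i) ('X - (c i)%:P)).[x] = \prod_(i | P i) (x - c i).
Proof. by rewrite horner_prod; apply: eq_bigr => i _; rewrite hornerXsubC. Qed.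

Lemma logderiv_prod_XsubC (K : fieldType) (n : nat) (a : 'I_n -> K) (x : K) :
  (forall i, x - a i != 0) ->
  ((\prod_i ('X - (a i)%:P))^`()).[x] =
    (\prod_i (x - a i)) * \sum_i (x - a i)^-1.
Proof.
move=> xa; elim: n a xa => [|n IHn] a xa.
  by rewrite !big_ord0 mulr0 -polyC1 derivC horner0.
rewrite !big_ord_recl derivM derivXsubC mul1r hornerD hornerM IHn //.
rewrite horner_prod_XsubC hornerXsubC mulrDr mulrAC mulfV ?xa // mul1r mulrA.
by congr (_ + _).
Qed.

(* Partial fraction coefficient of [\prod_i (x - b i) / \prod_i (x - a i)]
   at the pole [a j]. *)
Definition residue (K : fieldType) (n : nat) (a b : 'I_n -> K) (j : 'I_n) : K :=
  (\prod_i (a j - b i)) / \prod_(i | i != j) (a j - a i).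

(** Lagrange interpolation with denominators cleared: both products are monic of degree [n], so
    their difference has degree below [n] and is determined by its values at the [n] distinct points
    [a k]. At [a k] only the summand [j = k] survives, and [residue] is normalized to give the right
    value there. *)
Lemma prod_XsubC_partial_fractions (K : fieldType) (n : nat)
    (a b : 'I_n -> K) : injective a ->
  \prod_i ('X - (b i)%:P) = \prod_i ('X - (a i)%:P)
    + \sum_j residue a b j *: \prod_(i | i != j) ('X - (a i)%:P).
Proof.
move=> a_inj; apply/eqP; rewrite -subr_eq0 opprD addrA; apply/eqP.
apply: (@roots_geq_poly_eq0 _ _ [seq a i | i <- enum 'I_n]).
- apply/allP => _ /mapP[k _ ->]; apply/rootP.
  rewrite !(hornerD, hornerN) horner_sum !horner_prod_XsubC.
  rewrite [X in _ - X - _](bigD1 k) //= subrr mul0r subr0.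
  rewrite [X in _ - X](bigD1 k) //= [X in _ - (_ + X)]big1.
    rewrite addr0 hornerZ horner_prod_XsubC /residue divfK ?subrr //.
    by apply/prodf_neq0 => i ik; rewrite subr_eq0 (inj_eq a_inj) eq_sym.
  move=> j jk; rewrite hornerZ horner_prod_XsubC (bigD1 k) 1?eq_sym //=.
  by rewrite subrr mul0r mulr0.
- by rewrite map_inj_uniq ?enum_uniq.
(* Degree bound: in degree [n] the two leading coefficients cancel, above it all coefficients are
   zero, and each product omitting [j] has size only [n]. *)
- rewrite size_map size_enum_ord; apply/leq_sizeP => k nk.
  have monic_coef (c : 'I_n -> K) :
      (\prod_i ('X - (c i)%:P))`_k = (k == n)%:R.
    have sz : size (\prod_i ('X - (c i)%:P)) = n.+1.
      by rewrite -big_enum size_prod_XsubC size_enum_ord.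
    case: eqP => [->|/eqP kn].
      have /monicP := monic_prod_XsubC (index_enum 'I_n) predT c.
      by rewrite /lead_coef sz.
    by rewrite nth_default // sz ltn_neqAle eq_sym kn.
  rewrite !coefB !monic_coef subrr sub0r coef_sum big1 ?oppr0 // => j _.
  rewrite coefZ nth_default ?mulr0 // -(big_enum _ _ (predC1 j)).
  rewrite size_prod_XsubC -cardE cardC1 card_ord prednK //.
  exact: leq_ltn_trans (leq0n j) (ltn_ord j).
Qed.

(** With A and B the products over [a] and [b], this differentiates B/A = 1 + sum of r_j / (x -
    a_j): the left side is A times (B/A)', by logarithmic differentiation, and the right side is A
    times the termwise derivative. *)
Lemma prod_logderiv_partial_fractions (K : fieldType) (n : nat)
    (a b : 'I_n -> K) (x : K) : injective a ->
  (forall i, x - a i != 0) -> (forall i, x - b i != 0) ->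
  (\prod_i (x - b i)) * (\sum_i (x - b i)^-1 - \sum_i (x - a i)^-1) =
    - (\prod_i (x - a i)) * \sum_j residue a b j / (x - a j) ^+ 2.
Proof.
move=> a_inj xa xb; have PF := prod_XsubC_partial_fractions b a_inj.
set A := \prod_i (x - a i); set B := \prod_i (x - b i).
set Ha := \sum_i (x - a i)^-1; set Hb := \sum_i (x - b i)^-1.
have Aj j : \prod_(i | i != j) (x - a i) = A / (x - a j).
  by rewrite /A [in RHS](bigD1 j) //= mulrAC mulfV // mul1r.
(* Obtained by solving A' = A_j + (X - a_j) A_j' for A_j', where A_j is A without its factor at
   [j]. *)
have Aj' j : (\prod_(i | i != j) ('X - (a i)%:P))^`().[x]
    = A * (Ha / (x - a j) - (x - a j) ^- 2).
  have := logderiv_prod_XsubC xa; rewrite (bigD1 j) //= derivM derivXsubC.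
  rewrite mul1r hornerD horner_prod_XsubC Aj hornerM hornerXsubC.
  rewrite -/A -/Ha => eq_j.
  apply: (mulfI (xa j)); rewrite -[LHS](addKr (A / (x - a j))) eq_j.
  by field; apply: xa.
have Bx : B = A + \sum_j residue a b j * (A / (x - a j)).
  rewrite /B -horner_prod_XsubC PF hornerD horner_prod_XsubC horner_sum.
  congr (_ + _).
  by apply: eq_bigr => j _; rewrite hornerZ horner_prod_XsubC Aj.
have BHb : B * Hb = A * Ha
    + \sum_j residue a b j * (A * (Ha / (x - a j) - (x - a j) ^- 2)).
  rewrite -logderiv_prod_XsubC // PF derivD hornerD logderiv_prod_XsubC //.
  congr (_ + _); rewrite raddf_sum horner_sum.
  by apply: eq_bigr => j _; rewrite /= derivZ hornerZ Aj'.
rewrite mulrBr BHb Bx mulrDl opprD addrACA subrr add0r.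
rewrite mulr_suml mulr_sumr -sumrB; apply: eq_bigr => j _.
by field; apply: xa.
Qed.

(** * Harmonic numbers and summation by parts *)

Lemma gharmonic1 (K : fieldType) n (u : K) :
  gharmonic 1 n u = \sum_(i < n) (u + i.+1%:R)^-1.
Proof.
rewrite /gharmonic big_add1 big_mkord.
by apply: eq_bigr => i _; rewrite expr1 div1r.
Qed.

(** Abel summation. The partial sums of [a] enter through their recurrence, so that any closed form
    can be supplied as [S]. *)
Lemma sum_by_parts_gharmonic (K : fieldType) l (a S : nat -> K) (x : K) N :
  S 0%N = a 0%N -> (forall m, (m < N)%N -> S m.+1 = S m + a m.+1) ->
  \sum_(0 <= k < N.+1) a k * gharmonic l k x =
    S N * gharmonic l N x - \sum_(m < N) S m / (x + m.+1%:R) ^+ l.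
Proof.
move=> S0; elim: N => [|N IHN] Srec.
  by rewrite big_nat1 big_ord0 subr0 S0.
rewrite big_nat_recr //= IHN => [|m mN]; last by apply: Srec; apply: ltnW.
rewrite big_ord_recr /= Srec //.
have -> : gharmonic l N.+1 x = gharmonic l N x + 1 / (x + N.+1%:R) ^+ l.
  by rewrite /gharmonic big_nat_recr.
ring.
Qed.

(** * The identity in rising factorials: residues against partial sums *)

Lemma rising1 (K : fieldType) k : rising 1 k = k`!%:R :> K.
Proof.
elim: k => [|k IHk]; first by rewrite rising0.
by rewrite risingS IHk factS natrM mulrC -[k.+1]add1n natrD.
Qed.

(** Indices below [j] contribute the sign and [j]!, those above contribute (n - j)!. *)
Lemma prod_sub_node (K : fieldType) (n : nat) (j : 'I_n.+1) :
  \prod_(i < n.+1 | i != j) (i%:R - j%:R) =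
    (-1) ^+ j * j`!%:R * (n - j)`!%:R :> K.
Proof.
have j_le : (j <= n)%N by rewrite -ltnS.
rewrite -(big_mkord (fun i => i != j :> nat) (fun i => i%:R - j%:R : K)).
rewrite (@big_cat_nat _ _ _ j) //=; last exact: ltnW.
rewrite [X in _ * X]big_ltn_cond // eqxx /=; congr (_ * _).
  rewrite big_nat_cond (eq_bigl (fun i => (0 <= i < j)%N)); last first.
    by move=> i /=; case: ltngtP.
  rewrite -big_nat big_mkord; under eq_bigr do rewrite -opprB.
  by rewrite prodrN card_ord rising_rev subrr add0r rising1.
rewrite -rising1 /rising big_nat_cond (eq_bigl (fun i => (j.+1 <= i < n.+1)%N)).
  rewrite -big_nat -{1}[j.+1]add0n big_addn subSS.
  apply: eq_big_nat => i _; rewrite addnS -addn1 !natrD; ring.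
by move=> i /=; case: ltngtP => //=; rewrite andbT.
Qed.

(** The crux: up to a factor independent of [j], the residues of (x-y+1)_(n+1) / (x+1)_(n+1) are the
    partial sums that summation by parts produces. *)
Lemma residue_shifted_nodes (K : numFieldType) (n : nat) (y : K) (j : 'I_n.+1) :
  let z := y - n%:R in
  rising z n.+1 != 0 ->
  residue (fun i : 'I_n.+1 => - i.+1%:R) (fun i : 'I_n.+1 => y - i.+1%:R) j =
    (-1) ^+ n.+1 * rising z n.+1 / n`!%:R
    * ((-1) ^+ j * 'C(n, j)%:R * (rising (y + 1) j / rising z j)).
Proof.
move=> z z_neq0; have j_le : (j <= n)%N by rewrite -ltnS.
have zj_neq0 : rising z j != 0.
  apply: contra_neq z_neq0 => zj0.
  have -> : rising z n.+1 = rising z j * rising (z + j%:R) (n.+1 - j).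
    by rewrite -risingD subnKC // ltnW.
  by rewrite zj0 mul0r.
have num : \prod_(i < n.+1) (- j.+1%:R - (y - i.+1%:R)) =
    (-1) ^+ n.+1 * (rising z n.+1 * rising (y + 1) j / rising z j).
  (* Since y + 1 = z + n + 1, both sides equal the rising factorial of [z] of length n + 1 + j,
     split in two ways. *)
  have -> : rising z n.+1 * rising (y + 1) j =
      rising z j * rising (z + j%:R) n.+1.
    have -> : y + 1 = z + n.+1%:R by rewrite /z -natr1; ring.
    by rewrite -!risingD addnC.
  rewrite mulrAC mulfV // mul1r.
  have -> : z + j%:R = y + j%:R - n.+1%:R + 1 by rewrite /z -natr1; ring.
  rewrite -rising_rev -[in (-1) ^+ _](card_ord n.+1) -prodrN.
  by apply: eq_bigr => i _; rewrite -[j.+1%:R]natr1 -natr1; ring.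
(* Writing the sign as an inverse lets the division below return (-1)^j directly. *)
have den : \prod_(i < n.+1 | i != j) (- j.+1%:R - - i.+1%:R) =
    ((-1) ^+ j)^-1 * j`!%:R * (n - j)`!%:R :> K.
  rewrite invr_sign -prod_sub_node.
  by apply: eq_bigr => i _; rewrite -[j.+1%:R]natr1 -natr1; ring.
rewrite /residue num den -(bin_fact j_le) !natrM.
have fact_neq0 k : k`!%:R != 0 :> K by rewrite pnatr_eq0 -lt0n fact_gt0.
have bin_neq0 : 'C(n, j)%:R != 0 :> K by rewrite pnatr_eq0 -lt0n bin_gt0.
by field; rewrite signr_eq0 !fact_neq0 bin_neq0 zj_neq0.
Qed.

(* [S m] is the closed form of the [m]-th partial sum of the terminating series
   2F1(-n-1, y; y-n; 1). *)
Lemma hypergeometric_partial_sumS (K : fieldType) (n m : nat) (y : K) :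
  let z := y - n%:R in
  let S k := (-1) ^+ k * 'C(n, k)%:R * (rising (y + 1) k / rising z k) in
  (m <= n)%N -> rising z m.+1 != 0 ->
  S m.+1 = S m
    + (-1) ^+ m.+1 * 'C(n.+1, m.+1)%:R * (rising y m.+1 / rising z m.+1).
Proof.
move=> z S mn; rewrite risingS mulf_eq0 negb_or => /andP[zm_neq0 z_m].
have bin_rec : m.+1%:R * 'C(n, m.+1)%:R = (n%:R - m%:R) * 'C(n, m)%:R :> K.
  by rewrite -natrB // -!natrM mul_bin_left.
(* The claimed recurrence divided by (-1)^(m+1) (y+1)_m / (z)_(m+1); it reduces to [bin_rec]. *)
have key : 'C(n, m.+1)%:R * (y + 1 + m%:R) =
    ('C(n, m.+1)%:R + 'C(n, m)%:R) * y - 'C(n, m)%:R * (z + m%:R).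
  apply/eqP; rewrite -subr_eq0; apply/eqP.
  transitivity (m.+1%:R * 'C(n, m.+1)%:R - (n%:R - m%:R) * 'C(n, m)%:R : K).
    by rewrite -natr1 /z; ring.
  by rewrite bin_rec subrr.
transitivity ((-1) ^+ m.+1 * ('C(n, m.+1)%:R * (y + 1 + m%:R))
    * (rising (y + 1) m / (rising z m * (z + m%:R)))).
  by rewrite /S !risingS; ring.
rewrite key /S binS natrD exprS (risingSl y).
by field; rewrite z_m.
Qed.

Lemma sum_gharmonic2 (K : numFieldType) (n : nat) (x y : K) :
  let z := y - n%:R in
  (forall i, (i < n.+1)%N -> x + 1 + i%:R != 0) ->
  (forall i, (i < n.+1)%N -> x - y + 1 + i%:R != 0) ->
  (forall i, (i < n.+1)%N -> z + i%:R != 0) ->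
  \sum_(0 <= k < n.+2)
    (-1) ^+ k * 'C(n.+1, k)%:R * (rising y k / rising z k) * gharmonic 2 k x
  = (-1) ^+ n.+1 * n`!%:R * (rising (x - y + 1) n.+1
      / (rising (x + 1) n.+1 * rising z n.+1))
    * (gharmonic 1 n.+1 (x - y) - gharmonic 1 n.+1 x).
Proof.
move=> z x_neq0 xy_neq0 z_neq0.
have rz k : (k <= n.+1)%N -> rising z k != 0.
  by move=> kn; apply: rising_neq0 => i ik; apply: z_neq0; apply: leq_trans kn.
pose S k := (-1) ^+ k * 'C(n, k)%:R * (rising (y + 1) k / rising z k).
rewrite (@sum_by_parts_gharmonic _ 2 _ S); first 1 last.
- by rewrite /S !bin0 !rising0.
- by move=> m mn; apply: hypergeometric_partial_sumS => //; apply: rz.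
(* The boundary term vanishes because [S n.+1] contains 'C(n, n.+1) = 0. *)
rewrite {1}/S bin_small // mulr0 !mul0r sub0r.
(* The zeros in [x] of (x+1)_(n+1) and of (x-y+1)_(n+1). *)
pose a (i : 'I_n.+1) : K := - i.+1%:R.
pose b (i : 'I_n.+1) := y - i.+1%:R.
have xa i : x - a i = x + 1 + i%:R by rewrite /a -natr1; ring.
have xb i : x - b i = x - y + 1 + i%:R by rewrite /b -natr1; ring.
have a_inj : injective a.
  move=> i j /oppr_inj/eqP; rewrite eqr_nat eqSS => /eqP; exact: val_inj.
have prodA : \prod_i (x - a i) = rising (x + 1) n.+1.
  by rewrite /rising big_mkord; apply: eq_bigr.
have prodB : \prod_i (x - b i) = rising (x - y + 1) n.+1.
  by rewrite /rising big_mkord; apply: eq_bigr.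
have PF := @prod_logderiv_partial_fractions _ _ a b x a_inj.
rewrite prodA prodB in PF.
have rx : rising (x + 1) n.+1 != 0 by apply: rising_neq0.
have fact_neq0 : n`!%:R != 0 :> K by rewrite pnatr_eq0 -lt0n fact_gt0.
have sumA : \sum_i (x - a i)^-1 = gharmonic 1 n.+1 x.
  by rewrite gharmonic1; apply: eq_bigr => i _; rewrite /a opprK.
have sumB : \sum_i (x - b i)^-1 = gharmonic 1 n.+1 (x - y).
  by rewrite gharmonic1; apply: eq_bigr => i _; rewrite /b opprB addrA addrAC.
rewrite sumA sumB in PF.
rewrite -[RHS]mulrA mulrAC mulrA.
transitivity ((-1) ^+ n.+1 * n`!%:R / (rising (x + 1) n.+1 * rising z n.+1)
   * (rising (x - y + 1) n.+1
       * (gharmonic 1 n.+1 (x - y) - gharmonic 1 n.+1 x))); last by ring.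
rewrite PF => [|i|i]; rewrite ?xa ?xb ?x_neq0 ?xy_neq0 //.
rewrite !mulrA mulr_sumr -sumrN; apply: eq_bigr => j _.
rewrite residue_shifted_nodes ?rz // -/(S j) /a opprK.
(* One sign comes from the prefactor, the other from the residue. *)
have sgn : (-1) ^+ n.+1 * (-1) ^+ n.+1 = 1 :> K by rewrite -expr2 sqrr_sign.
transitivity ((-1) ^+ n.+1 * (-1) ^+ n.+1 * - (S j / (x + j.+1%:R) ^+ 2)).
  by rewrite sgn mul1r.
have := x_neq0 j (ltn_ord j); rewrite -addrA => xj_neq0.
by field; rewrite xj_neq0 fact_neq0 rx rz.
Qed.

(** * Translation to generalized binomials *)

Theorem theorem6 (R : realType) (n : nat) (x y : R[i])
  (hn : (1 <= n)%N)
  (hx : forall k : nat, (1 <= k <= n)%N -> x != - k%:R)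
  (hxy : forall k : nat, (1 <= k <= n)%N -> x - y != - k%:R)
  (hy : forall j : int, - n%:Z <= j <= n%:Z - 1 -> y != j%:~R) :
  \sum_(0 <= k < n.+1)
    (-1) ^+ k * 'C(n, k)%:R
    * (gbinom (y + k%:R) k / gbinom (y - n%:R + k%:R) k)
    * (y / (y + k%:R)) * gharmonic 2 k x
  = (-1) ^+ n / n%:R
    * (gbinom (x - y + n%:R) n / (gbinom (x + n%:R) n * gbinom y n))
    * (gharmonic 1 n (x - y) - gharmonic 1 n x).
Proof.
case: n hn hx hxy hy => // n _ hx hxy hy.
(* The excluded values j >= 0 of [y] are used here; those with j <= 0 give [y_neq0]. *)
have z_neq0 i : (i < n.+1)%N -> y - n%:R + i%:R != 0.
  move=> i_n; have -> : y - n%:R + i%:R = y - (n%:Z - i%:Z)%:~R.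
    by rewrite rmorphB /= -!pmulrn; ring.
  by rewrite subr_eq0; apply: hy; lia.
have y_neq0 i : (i < n.+2)%N -> y + i%:R != 0.
  move=> i_n; have -> : y + i%:R = y - (- i%:Z)%:~R.
    by rewrite rmorphN /= -pmulrn opprK.
  by rewrite subr_eq0; apply: hy; lia.
have shift_neq0 (u : R[i]) :
    (forall k : nat, (1 <= k <= n.+1)%N -> u != - k%:R) ->
    forall i, (i < n.+1)%N -> u + 1 + i%:R != 0.
  move=> hu i i_n; have := hu i.+1 i_n.
  by rewrite -subr_eq0 opprK -natr1 -addrA [1 + _]addrC.
have zE : y - n.+1%:R + 1 = y - n%:R by rewrite -natr1; ring.
have fact_neq0 k : k`!%:R != 0 :> R[i] by rewrite pnatr_eq0 -lt0n fact_gt0.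
transitivity (\sum_(0 <= k < n.+2) (-1) ^+ k * 'C(n.+1, k)%:R
    * (rising y k / rising (y - n%:R) k) * gharmonic 2 k x).
  apply: eq_big_nat => k /andP[_ kn]; congr (_ * _).
  rewrite -mulrA; congr (_ * _); rewrite !gbinom_rising zE.
  (* The factor y / (y + k) turns (y+1)_k into (y)_k. *)
  have -> : rising y k = y * rising (y + 1) k / (y + k%:R).
    by rewrite -risingSl risingS mulfK ?y_neq0.
  have rz_neq0 : rising (y - n%:R) k != 0.
    by apply: rising_neq0 => i ik; apply: z_neq0; apply: leq_trans ik _.
  by field; rewrite fact_neq0 rz_neq0 y_neq0.
rewrite sum_gharmonic2 //; [|exact: shift_neq0..].
(* Here [y] is read as (y - (n+1)) + (n+1) to fit [gbinom_rising]. *)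
have -> : gbinom y n.+1 = rising (y - n%:R) n.+1 / n.+1`!%:R.
  by rewrite -[y in LHS](subrK n.+1%:R) gbinom_rising zE.
rewrite !gbinom_rising factS natrM.
have rz_neq0 : rising (y - n%:R) n.+1 != 0 by apply: rising_neq0.
have rx_neq0 : rising (x + 1) n.+1 != 0.
  by apply: rising_neq0; apply: shift_neq0.
have n_neq0 : n.+1%:R != 0 :> R[i] by rewrite pnatr_eq0.
by field; rewrite nat1r n_neq0 fact_neq0 rz_neq0 rx_neq0.
Qed.
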